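(* For the subclass $(1,2,0)$ of systems, i.e. the systems consisting of one form of one of the following four types, 1) $S=\{\forall x\in S\,\forall y\in S\ p(x,y)\}$, 2) $S=\{\forall x\in S\,\exists y\in S\ p(x,y)\}$, 3) $S=\{\exists x\in S\,\forall y\in S\ p(x,y)\}$, 4) $S=\{\exists x\in S\,\exists y\in S\ p(x,y)\}$, there exists an algorithm of data selection (building a selected set for $S$) that is polynomial in the size of the data universe.
   Context: An interpretation of such a system is a finite set $V$ (the data universe) with a binary predicate $p:V\times V\to\{\text{true},\text{false}\}$. A set $M\subset V$ is agreed with the form $S=\{Q_1x\in S\,Q_2y\in S\ p(x,y)\}$ if the formula $Q_1x\in M\,Q_2y\in M\ p(x,y)$ (quantifiers ranging over $M$) is true. $M$ is a selected set for $S$ (a variant of selection, denoted $M(S)$) if it is agreed with the form and is maximal in the sense that it cannot be increased by adding only one element so as to remain agreed with the form. Data selection means constructing, from $V$ and $p$, a selected set for $S$ (or detecting that it is empty/absent). Complexity is measured as a function of the size of $V$. *)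

(* Defs.v *)
From HB Require Import structures.
From mathcomp Require Import all_boot all_order all_algebra.

Set Implicit Arguments.
Unset Strict Implicit.
Unset Printing Implicit Defensive.

Inductive quantifier := All | Ex.

(* [Form Q1 Q2] is the form S = {Q1 x in S, Q2 y in S, p(x, y)}; its four
   values are the four types of forms. *)
Record sel_form := Form { outer : quantifier; inner : quantifier }.

Definition quantify (Q : quantifier) (V : finType) (M : {set V}) (P : pred V)
    : bool :=
  match Q with
  | All => [forall x in M, P x]
  | Ex => [exists x in M, P x]
  end.

Definition agreed (V : finType) (f : sel_form) (p : rel V) (M : {set V})
    : bool :=
  quantify (outer f) M (fun x => quantify (inner f) M (fun y => p x y)).

(* Maximality is only with respect to adding a single element: a selected set
   need not be maximal for inclusion among the agreed sets. *)
Definition selected (V : finType) (f : sel_form) (p : rel V) (M : {set V})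
    : bool :=
  agreed f p M && [forall x, (x \notin M) ==> ~~ agreed f p (x |: M)].

(* Outcome of data selection: [Some M] gives a selected set, [None] reports
   that there is none.  The empty set may be selected for the forms starting
   with All; returning it also reports that no other set is selected. *)
Definition selection_outcome (V : finType) (f : sel_form) (p : rel V)
    (r : option {set V}) : Prop :=
  match r with
  | Some M => selected f p M /\
      (M = set0 -> forall N : {set V}, selected f p N -> N = set0)
  | None => forall M : {set V}, ~~ selected f p M
  end.

(* The model of computation is a random access machine programmed with
   structured control flow.  It has natural-number registers, a
   natural-number memory with indirect addressing, and can evaluate the
   predicate p on two elements given by their numbers.  Each instruction and
   each test costs one.  The only arithmetic is the successor, so the numbers
   in a run of t steps exceed the initial ones by at most t: up to a
   polynomial, this uniform cost is Turing machine time. *)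
Inductive prog :=
| Skip
| Zero (d : nat)
| Succ (d : nat)
| Move (d a : nat)
| Fetch (d a : nat)
| Store (a b : nat)
| Query (d a b : nat)
| Seq (c1 c2 : prog)
| IfLt (a b : nat) (c1 c2 : prog)
| WhileLt (a b : nat) (c : prog).

Record state := State { reg : nat -> nat; mem : nat -> nat }.

Definition upd (g : nat -> nat) (i v : nat) : nat -> nat :=
  fun j => if j == i then v else g j.

Definition set_reg (s : state) (d v : nat) : state :=
  State (upd (reg s) d v) (mem s).

Definition set_mem (s : state) (i v : nat) : state :=
  State (reg s) (upd (mem s) i v).

(* [exec q c s t s']: with q answering the queries, the program c started in
   state s halts in state s' after t steps. *)
Inductive exec (q : nat -> nat -> bool)
    : prog -> state -> nat -> state -> Prop :=
| ExecSkip s : exec q Skip s 1 s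
| ExecZero s d : exec q (Zero d) s 1 (set_reg s d 0)
| ExecSucc s d : exec q (Succ d) s 1 (set_reg s d (reg s d).+1)
| ExecMove s d a : exec q (Move d a) s 1 (set_reg s d (reg s a))
| ExecFetch s d a : exec q (Fetch d a) s 1 (set_reg s d (mem s (reg s a)))
| ExecStore s a b : exec q (Store a b) s 1 (set_mem s (reg s a) (reg s b))
| ExecQuery s d a b :
    exec q (Query d a b) s 1 (set_reg s d (q (reg s a) (reg s b)))
| ExecSeq c1 c2 s1 s2 s3 t1 t2 :
    exec q c1 s1 t1 s2 -> exec q c2 s2 t2 s3 ->
    exec q (Seq c1 c2) s1 (t1 + t2) s3
| ExecIfTrue a b c1 c2 s t s' :
    reg s a < reg s b -> exec q c1 s t s' ->
    exec q (IfLt a b c1 c2) s t.+1 s'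
| ExecIfFalse a b c1 c2 s t s' :
    reg s b <= reg s a -> exec q c2 s t s' ->
    exec q (IfLt a b c1 c2) s t.+1 s'
| ExecWhileTrue a b c s1 s2 s3 t1 t2 :
    reg s1 a < reg s1 b -> exec q c s1 t1 s2 ->
    exec q (WhileLt a b c) s2 t2 s3 ->
    exec q (WhileLt a b c) s1 (t1 + t2).+1 s3
| ExecWhileFalse a b c s :
    reg s b <= reg s a -> exec q (WhileLt a b c) s 1 s.

(* The elements of V are numbered by [enum_rank]; queries about numbers
   outside the range are answered negatively. *)
Definition oracle (V : finType) (p : rel V) (i j : nat) : bool :=
  [exists x : V, exists y : V,
    [&& enum_rank x == i :> nat, enum_rank y == j :> nat & p x y]].

Definition code (Q : quantifier) : nat :=
  match Q with All => 0 | Ex => 1 end.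

Definition init (f : sel_form) (n : nat) : state :=
  State (fun r => match r with
                  | 0 => n
                  | 1 => code (outer f)
                  | 2 => code (inner f)
                  | _ => 0
                  end)
        (fun=> 0).

Definition output (V : finType) (s : state) : option {set V} :=
  if reg s 0 == 0 then None else Some [set x : V | mem s (enum_rank x) != 0].

(* Main.v *)
(** The programs contain only loops that count up to the size n of the universe,
    so their running time is bounded by a polynomial in n read off their
    syntax, and their effect is a total function.  The four forms are treated
    as follows.
    - All, All: an agreed set is a clique, loops included; one greedy pass
      suffices because an element rejected once stays rejected.
    - All, Ex: agreed sets are closed under union; the largest one is what
      remains of V after n rounds of deleting the elements without successor.
    - Ex, All: starting from the empty set, one pass over x replaces M by
      N(x) = {y | p(x, y)} whenever p(x, x) and M is included in N(x).  As M
      only grows, a witness x for a proper extension of the final M would have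
      enlarged M when it was visited.
    - Ex, Ex: if p holds somewhere then V itself is selected, and otherwise no
      set is agreed. *)
Require Import Defs.
From HB Require Import structures.
From mathcomp Require Import all_boot all_order all_algebra.

Set Implicit Arguments.
Unset Strict Implicit.
Unset Printing Implicit Defensive.

(** * Counting programs: total semantics and polynomial running time *)

Fixpoint writes (c : prog) : seq nat :=
  match c with
  | Zero d | Succ d | Move d _ | Fetch d _ | Query d _ _ => [:: d]
  | Seq c1 c2 | IfLt _ _ c1 c2 => writes c1 ++ writes c2
  | WhileLt _ _ c => writes c
  | Skip | Store _ _ => [::]
  end.

(* A loop counts up to register 0, which holds the size of the universe. *)
Fixpoint counting (c : prog) : bool :=
  match c with
  | Seq c1 c2 | IfLt _ _ c1 c2 => counting c1 && counting c2
  | WhileLt a b c =>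
      [&& b == 0, counting c
        & if c is Seq c' (Succ d) then (d == a) && (a \notin writes c')
          else false]
  | _ => true
  end.

(* Meaningful for counting programs only: the number of iterations is read
   off the registers when the loop is entered. *)
Fixpoint eval (q : nat -> nat -> bool) (c : prog) (s : state) : state :=
  match c with
  | Skip => s
  | Zero d => set_reg s d 0
  | Succ d => set_reg s d (reg s d).+1
  | Move d a => set_reg s d (reg s a)
  | Fetch d a => set_reg s d (Defs.mem s (reg s a))
  | Store a b => set_mem s (reg s a) (reg s b)
  | Query d a b => set_reg s d (q (reg s a) (reg s b))
  | Seq c1 c2 => eval q c2 (eval q c1 s)
  | IfLt a b c1 c2 => if reg s a < reg s b then eval q c1 s else eval q c2 s
  | WhileLt a b c => iter (reg s b - reg s a) (eval q c) s
  end.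

(** The indeterminate stands for the size of the universe. A branch is charged the sum of both
    sides, as a maximum would leave the polynomials. *)
Fixpoint cost (c : prog) : {poly nat} :=
  match c with
  | Seq c1 c2 => cost c1 + cost c2
  | IfLt _ _ c1 c2 => 1 + (cost c1 + cost c2)
  | WhileLt _ _ c => 1 + 'X * (1 + cost c)
  | _ => 1
  end%R.

Section Evaluation.
Variable q : nat -> nat -> bool.

Lemma eval_frame c s r : r \notin writes c -> reg (eval q c s) r = reg s r.
Proof.
elim: c s => //=.
- by move=> d s; rewrite inE /upd => /negPf->.
- by move=> d s; rewrite inE /upd => /negPf->.
- by move=> d a s; rewrite inE /upd => /negPf->.
- by move=> d a s; rewrite inE /upd => /negPf->.
- by move=> d a b s; rewrite inE /upd => /negPf->.
- move=> c1 IH1 c2 IH2 s; rewrite mem_cat negb_or => /andP[h1 h2].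
  by rewrite IH2 // IH1.
- move=> a b c1 IH1 c2 IH2 s; rewrite mem_cat negb_or => /andP[h1 h2].
  by case: ifP => _; [rewrite IH1|rewrite IH2].
- by move=> a b c IH s h; elim: (_ - _) => //= k IHk; rewrite IH.
Qed.

(** Since register 0 never changes, the costs of all subprograms and rounds are evaluated at the
    same point. *)
Lemma exec_eval c s : counting c -> 0 \notin writes c ->
  exists2 t, t <= (cost c).[reg s 0]%R & exec q c s t (eval q c s).
Proof.
elim: c s => /=; try by move=> *; exists 1; rewrite ?hornerE //; constructor.
- move=> c1 IH1 c2 IH2 s /andP[w1 w2].
  rewrite mem_cat negb_or => /andP[h1 h2].
  have [t1 le1 e1] := IH1 s w1 h1; have [t2 le2 e2] := IH2 (eval q c1 s) w2 h2.
  exists (t1 + t2); last exact: ExecSeq e1 e2.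
  by rewrite hornerD leq_add // -(eval_frame s h1).
- move=> a b c1 IH1 c2 IH2 s /andP[w1 w2].
  rewrite mem_cat negb_or => /andP[h1 h2]; rewrite !hornerE.
  case: ltnP => ab.
    have [t le_t e] := IH1 s w1 h1; exists t.+1; last exact: ExecIfTrue.
    by rewrite ltnS (leq_trans le_t) // leq_addr.
  have [t le_t e] := IH2 s w2 h2; exists t.+1; last exact: ExecIfFalse.
  by rewrite ltnS (leq_trans le_t) // leq_addl.
- move=> a b c IH s /and3P[/eqP-> wc count_a] h0; rewrite !hornerE.
  (* The final [Succ] is the only write to the counter in the body. *)
  have incr_a s1 : reg (eval q c s1) a = (reg s1 a).+1.
    case: c count_a {IH wc h0} => // c' [] //= d /andP[/eqP-> ha].
    by rewrite /upd eqxx eval_frame.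
  (* The induction on rounds needs the exact number of remaining rounds; the cost only uses that it
     is at most [reg s 0]. *)
  suff [t le_t e] : exists2 t,
      t <= 1 + (reg s 0 - reg s a) * (1 + (cost c).[reg s 0]%R)
      & exec q (WhileLt a 0 c) s t (iter (reg s 0 - reg s a) (eval q c) s).
    exists t => //; apply: leq_trans le_t _.
    by rewrite leq_add2l leq_mul2r leq_subr orbT.
  move Ek: (reg s 0 - reg s a) => k; elim: k s Ek => [|k IHk] s Ek.
    by exists 1; rewrite ?addn0 //; apply: ExecWhileFalse; rewrite -subn_eq0 Ek.
  have [t1 le1 e1] := IH s wc h0.
  have frame0 := eval_frame s h0.
  have [|t2 le2 e2] := IHk (eval q c s).
    by rewrite frame0 incr_a subnS Ek.
  rewrite frame0 in le2.
  exists (t1 + t2).+1.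
    by rewrite add1n ltnS mulSn -addnA addnCA leq_add.
  rewrite iterSr; apply: ExecWhileTrue e1 e2.
  by rewrite -subn_gt0 Ek.
Qed.

End Evaluation.

(** * The selection program *)

Definition For (d : nat) (c : prog) : prog :=
  Seq (Zero d) (WhileLt d 0 (Seq c (Succ d))).

(* Register 3 is never written and holds 0, register 4 holds 1; register 6
   is the current element, register 7 scans the universe, register 8 collects
   the result of a scan, and register 5 tells whether a set is selected. *)
Definition forall_scan (a b : nat) : prog :=
  For 7 (Seq (Fetch 9 7)
    (IfLt 3 9 (Seq (Query 9 a b) (IfLt 3 9 Skip (Zero 8))) Skip)).

Definition exists_scan : prog :=
  For 7 (Seq (Fetch 9 7)
    (IfLt 3 9 (Seq (Query 9 6 7) (IfLt 3 9 (Move 8 9) Skip)) Skip)).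

Definition copy_row : prog := For 7 (Seq (Query 9 6 7) (Store 7 9)).

Definition fill : prog := For 6 (Store 6 4).

(** The relation need not be symmetric, hence one scan in each direction. *)
Definition greedy_clique : prog :=
  For 6 (Seq (Query 8 6 6) (Seq (forall_scan 6 7) (Seq (forall_scan 7 6)
    (IfLt 3 8 (Store 6 8) Skip)))).

Definition prune : prog :=
  For 6 (Seq (Zero 8) (Seq exists_scan (IfLt 3 8 Skip (Store 6 3)))).

Definition ascend : prog :=
  For 6 (Seq (Query 8 6 6) (Seq (forall_scan 6 7)
    (IfLt 3 8 (Seq (Move 5 4) copy_row) Skip))).

Definition shrink : prog := Seq fill (For 10 prune).

Definition find_pair : prog := Seq fill (For 6 exists_scan).

Definition select : prog :=
  Seq (Succ 4)
    (IfLt 3 1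
      (IfLt 3 2 (Seq find_pair (Move 5 8)) ascend)
      (IfLt 3 2 (Seq shrink (Move 5 4)) (Seq greedy_clique (Move 5 4)))).

(** * Loops over the universe and their invariants *)

Section Universe.
Variables (V : finType) (p : rel V).
Notation ev := (eval (oracle p)).

Definition marked (m : nat -> nat) : {set V} :=
  [set x | m (enum_rank x) != 0].

Lemma oracle_rank x y : oracle p (enum_rank x) (enum_rank y) = p x y.
Proof.
apply/existsP/idP => [[x' /existsP[y' /and3P[/eqP ex /eqP ey]]]|pxy].
  by rewrite (enum_rank_inj (val_inj ex)) (enum_rank_inj (val_inj ey)).
by exists x; apply/existsP; exists y; rewrite !eqxx.
Qed.

Lemma marked_upd m x v : marked (upd m (enum_rank x) v) =
  if v == 0 then marked m :\ x else x |: marked m.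
Proof.
apply/setP => y; case: eqP => [->|/eqP v0];
  by rewrite /upd !inE (inj_eq val_inj) (inj_eq enum_rank_inj); case: (y =P x).
Qed.

(** Invariant rule for [For]: [I] is indexed by the prefix of [enum V] already visited, and
    registers that the loop does not write may be read off the initial state. *)
Lemma for_ind d c (I : seq V -> state -> Prop) s :
    reg s 0 = #|V| -> d != 0 -> 0 \notin writes c -> d \notin writes c ->
    I [::] (set_reg s d 0) ->
    (forall xs x s', {in [predC d :: writes c], reg s' =1 reg s} ->
       reg s' d = enum_rank x -> I xs s' ->
       I (rcons xs x) (ev (Seq c (Succ d)) s')) ->
  I (enum V) (ev (For d c) s).
Proof.
move=> s0 d0 c0 cd I0 IS.
have frame0 : {in [predC d :: writes c], reg (set_reg s d 0) =1 reg s}.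
  by move=> r; rewrite !inE negb_or /= /upd => /andP[/negPf->].
suff loop k : k <= #|V| ->
    let s' := iter k (ev (Seq c (Succ d))) (set_reg s d 0) in
    [/\ {in [predC d :: writes c], reg s' =1 reg s}, reg s' d = k
      & I (take k (enum V)) s'].
  rewrite /For /= /upd eqxx eq_sym (negPf d0) s0 subn0.
  by have [_ _] := loop _ (leqnn _); rewrite {1}cardE take_size.
elim: k => [_|k IHk ltkn] /=.
  by rewrite take0; split => //; rewrite /upd eqxx.
have [frame eqk Ik] := IHk (ltnW ltkn); rewrite /= in frame eqk Ik.
set s' := iter k _ _ in frame eqk Ik *.
have s'd : reg (ev c s') d = k by rewrite eval_frame.
split.
- move=> r hr; move: (hr); rewrite !inE negb_or /= /upd => /andP[/negPf-> hrc].
  by rewrite eval_frame ?frame.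
- by rewrite /upd eqxx s'd.
have -> : take k.+1 (enum V)
    = rcons (take k (enum V)) (enum_val (Ordinal ltkn)).
  have x0 := enum_val (Ordinal ltkn).
  by rewrite (take_nth x0) -?cardE // (enum_val_nth x0).
by apply: IS => //; rewrite enum_valK.
Qed.

Lemma all_enum (P : pred V) : all P (enum V) = [forall x, P x].
Proof.
by apply/allP/forallP => [h x|h x _]; [apply: h; rewrite mem_enum|apply: h].
Qed.

Lemma has_enum (P : pred V) : has P (enum V) = [exists x, P x].
Proof.
by apply/hasP/existsP => [[x _ Px]|[x Px]]; exists x; rewrite ?mem_enum.
Qed.

(** The abstract [P] covers both the row and the column of the current element; the incoming flag
    [c] allows scans to be chained. *)
Lemma forall_scanP a b (P : pred V) (c : bool) s :
    reg s 0 = #|V| -> reg s 3 = 0 -> reg s 8 = c ->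
    (forall s' y, reg s' 6 = reg s 6 -> reg s' 7 = enum_rank y ->
       oracle p (reg s' a) (reg s' b) = P y) ->
  let s' := ev (forall_scan a b) s in
  Defs.mem s' = Defs.mem s /\
  reg s' 8 = c && [forall y in marked (Defs.mem s), P y].
Proof.
move=> s0 s3 s8 hP; rewrite -all_enum.
pose I xs s' := Defs.mem s' = Defs.mem s /\
  reg s' 8 = c && all (fun y => (y \in marked (Defs.mem s)) ==> P y) xs.
apply: (@for_ind 7 _ I) => //; first by rewrite /I /= andbT.
move=> xs y s' frame s'7 [memE s'8].
have s'3 : reg s' 3 = 0 by rewrite frame.
have Py := hP (set_reg s' 9 (Defs.mem s (enum_rank y))) y.
rewrite /= /upd /= frame // in Py; move/(_ erefl s'7) in Py.
rewrite /I all_rcons /= /upd /= memE s'3 s'7 /= !inE !lt0n Py.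
case: (Defs.mem s (enum_rank y) =P 0) => My; first by rewrite /= /upd /= s'8.
by case: (P y); rewrite /= /upd /= ?andbF.
Qed.

Lemma forall_scan_frame a b s r :
  r \notin [:: 7; 8; 9] -> reg (ev (forall_scan a b) s) r = reg s r.
Proof.
move=> r789; apply: eval_frame; move: r789; rewrite /= !inE.
by case: (r == 7); case: (r == 8); case: (r == 9).
Qed.

Lemma exists_scanP x (c : bool) s :
    reg s 0 = #|V| -> reg s 3 = 0 -> reg s 6 = enum_rank x -> reg s 8 = c ->
  let s' := ev exists_scan s in
  Defs.mem s' = Defs.mem s /\
  reg s' 8 = c || [exists y in marked (Defs.mem s), p x y].
Proof.
move=> s0 s3 s6 s8; rewrite -has_enum.
pose I xs s' := Defs.mem s' = Defs.mem s /\
  reg s' 8 = c || has (fun y => (y \in marked (Defs.mem s)) && p x y) xs.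
apply: (@for_ind 7 _ I) => //; first by rewrite /I /= orbF.
move=> xs y s' frame s'7 [memE s'8].
have s'3 : reg s' 3 = 0 by rewrite frame.
have s'6 : reg s' 6 = enum_rank x by rewrite frame.
rewrite /I has_rcons /= /upd /= memE s'3 s'7 s'6 /= !inE !lt0n oracle_rank.
case: (Defs.mem s (enum_rank y) =P 0) => My; first by rewrite /= /upd /= s'8.
by case: (p x y); rewrite /= /upd /= ?orbT.
Qed.

Lemma exists_scan_frame s r :
  r \notin [:: 7; 8; 9] -> reg (ev exists_scan s) r = reg s r.
Proof.
move=> r789; apply: eval_frame; move: r789; rewrite /= !inE.
by case: (r == 7); case: (r == 8); case: (r == 9).
Qed.

Lemma copy_rowP x s : reg s 0 = #|V| -> reg s 6 = enum_rank x ->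
  marked (Defs.mem (ev copy_row s)) = [set y | p x y].
Proof.
move=> s0 s6.
suff h : {in enum V, forall y,
    (y \in marked (Defs.mem (ev copy_row s))) = p x y}.
  by apply/setP => y; rewrite h ?mem_enum // inE.
apply: (@for_ind 7 _ (fun xs s' =>
  {in xs, forall y, (y \in marked (Defs.mem s')) = p x y})) => //.
move=> xs y s' frame s'7 IH z; rewrite mem_rcons inE => zy /=.
rewrite /upd /= s'7 frame // s6 oracle_rank marked_upd.
case: eqP zy => [-> _|/eqP zy /= /IH <-].
  by case: (p x y); rewrite !inE eqxx.
by case: (p x y); rewrite !inE (negPf zy).
Qed.

Lemma fillP s : reg s 0 = #|V| -> reg s 4 != 0 ->
  marked (Defs.mem (ev fill s)) = setT.
Proof.
move=> s0 s4.
suff h : {subset enum V <= marked (Defs.mem (ev fill s))}.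
  by apply/setP => y; rewrite h ?mem_enum // inE.
apply: (@for_ind 6 _ (fun xs s' =>
  {subset xs <= marked (Defs.mem s')})) => //.
move=> xs y s' frame s'6 IH z; rewrite mem_rcons inE /=.
rewrite s'6 frame // marked_upd (negPf s4) in_setU1.
by case: eqP => //= _; apply: IH.
Qed.


(* Keeps /= from unfolding the loops. *)
#[local] Opaque forall_scan exists_scan copy_row.

(** * The form All, All *)

Lemma greedy_cliqueP s :
    reg s 0 = #|V| -> reg s 3 = 0 -> marked (Defs.mem s) = set0 ->
  let M := marked (Defs.mem (ev greedy_clique s)) in
  selected (Form All All) p M /\
  (M = set0 -> forall N, selected (Form All All) p N -> N = set0).
Proof.
move=> s0 s3 M0 M.
have agreedP (N : {set V}) :
    reflect {in N &, forall x y, p x y} (agreed (Form All All) p N).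
  apply: (iffP forall_inP) => h x => [y xN|xN].
    exact: (forall_inP (h x xN)).
  by apply/forall_inP => y; apply: h.
have agreed_sub (N N' : {set V}) : N \subset N' ->
    agreed (Form All All) p N' -> agreed (Form All All) p N.
  move=> /subsetP sub /agreedP h; apply/agreedP => x y /sub xN /sub.
  exact: h.
(* Apart from agreement of [N], these are the three tests made by the loop body. *)
have agreed_add x N : agreed (Form All All) p (x |: N) =
    [&& agreed (Form All All) p N, p x x, [forall y in N, p x y]
      & [forall y in N, p y x]].
  apply/agreedP/and4P => [h|[/agreedP hN pxx /forall_inP px /forall_inP py]].
    split; first (by apply/agreedP => y z yN zN; apply: h;
      rewrite !inE ?yN ?zN orbT);
      try (apply/forall_inP => y yN); by apply: h; rewrite !inE ?eqxx ?yN ?orbT.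
  move=> y z /setU1P[->|yN] /setU1P[->|zN] //;
    by [apply: px|apply: py|apply: hN].
have [M_agreed Mmax] : agreed (Form All All) p M /\
    {in enum V, forall x, x \notin M -> ~~ agreed (Form All All) p (x |: M)}.
  apply: (@for_ind 6 _ (fun xs s' => let M := marked (Defs.mem s') in
    agreed (Form All All) p M /\
    {in xs, forall x, x \notin M ->
      ~~ agreed (Form All All) p (x |: M)})) => //.
    by split; rewrite //= M0; apply/agreedP => x y; rewrite inE.
  move=> xs x s' frame s'6 [s'_agreed s'max].
  have s'3 : reg s' 3 = 0 by rewrite frame.
  have s'0 : reg s' 0 = #|V| by rewrite frame.
  pose s1 := ev (Query 8 6 6) s'; pose s2 := ev (forall_scan 6 7) s1.
  pose s3' := ev (forall_scan 7 6) s2.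
  have frame2 r : r \notin [:: 7; 8; 9] -> reg s2 r = reg s' r.
    move=> hr; rewrite forall_scan_frame // /s1 /= /upd.
    by move: hr; rewrite !inE => /norP[_ /norP[/negPf-> _]].
  have frame3 r : r \notin [:: 7; 8; 9] -> reg s3' r = reg s' r.
    by move=> hr; rewrite forall_scan_frame ?frame2.
  have [|||| mem2 r2] := @forall_scanP 6 7 (p x) (p x x) s1; rewrite ?/upd //=.
  - by rewrite s'6 oracle_rank.
  - by move=> s'' y -> ->; rewrite /upd /= s'6 oracle_rank.
  have s20 : reg s2 0 = #|V| by rewrite frame2.
  have s23 : reg s2 3 = 0 by rewrite frame2.
  have [|mem3 r3] := forall_scanP (a := 7) (b := 6) (P := p^~ x) s20 s23 r2.
    by move=> s'' y -> ->; rewrite frame2 // s'6 oracle_rank.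
  rewrite -/s2 -/s3' mem2 /= in mem3 r3 *; rewrite -/s1 -/s2 -/s3'.
  rewrite r3 frame3 // s'3 lt0b frame3 // s'6.
  set N := marked (Defs.mem s') in s'_agreed s'max r3 *.
  have add_x : agreed (Form All All) p (x |: N)
      = (p x x && [forall y in N, p x y]) && [forall y in N, p y x].
    by rewrite agreed_add s'_agreed /= andbA.
  rewrite -add_x; case: ifP => ok /=; rewrite mem3 -/N ?marked_upd.
  - rewrite ?ok /= -/N; split => // y; rewrite mem_rcons inE.
    case: eqP => [->|_ /= yxs]; first by rewrite setU11.
    (* An earlier rejection of [y] persists: agreement passes to subsets. *)
    rewrite in_setU1 negb_or => /andP[_ yN]; apply: contra (s'max _ yxs yN).
    exact: agreed_sub (setUS _ (subsetUr _ _)).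
  - split => // y; rewrite mem_rcons inE.
    by case: eqP => [-> _ _|_ /= yxs]; [rewrite ok|apply: s'max].
split.
  rewrite /selected M_agreed; apply/forallP => x; apply/implyP.
  by apply: Mmax; rewrite mem_enum.
(* If [M] is empty, every singleton was rejected, yet an element [x] of an agreed [N] satisfies
   [p x x]. *)
move=> M00 N /andP[/agreedP hN _]; apply/setP => x; rewrite inE.
apply/negP => xN; have := Mmax x; rewrite mem_enum M00 !inE => /(_ isT isT).
move/negP; apply; apply/agreedP => y z; rewrite !inE !orbF => /eqP-> /eqP->.
exact: hN.
Qed.

(** * The form Ex, All *)

Lemma ascendP s :
    reg s 0 = #|V| -> reg s 3 = 0 -> reg s 4 = 1 -> reg s 5 = 0 ->
    marked (Defs.mem s) = set0 ->
  let s' := ev ascend s in let M := marked (Defs.mem s') in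
  if reg s' 5 == 0 then forall N, ~~ agreed (Form Ex All) p N
  else M != set0 /\ selected (Form Ex All) p M.
Proof.
move=> s0 s3 s4 s5 M0 s' M.
pose row x := [set y | p x y].
have agreedP (N : {set V}) :
    reflect (exists2 x, x \in N & N \subset row x) (agreed (Form Ex All) p N).
  apply: (iffP exists_inP) => -[x xN].
    by move=> /forall_inP h; exists x => //; apply/subsetP => y /h; rewrite inE.
  by move=> /subsetP h; exists x => //; apply/forall_inP => y /h; rewrite inE.
have [M5 M_agreed Mmax] : [/\ reg s' 5 = 0 -> M = set0,
    reg s' 5 <> 0 -> agreed (Form Ex All) p M
  & {in enum V, forall x, p x x -> M \subset row x -> M = row x}].
  apply: (@for_ind 6 _ (fun xs s' => let M := marked (Defs.mem s') in
    [/\ reg s' 5 = 0 -> M = set0,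
        reg s' 5 <> 0 -> agreed (Form Ex All) p M
      & {in xs, forall x, p x x -> M \subset row x -> M = row x}])) => //.
  move=> xs x s1 frame s16 [M15 M1_agreed M1max].
  have s10 : reg s1 0 = #|V| by rewrite frame.
  have s13 : reg s1 3 = 0 by rewrite frame.
  have s14 : reg s1 4 = 1 by rewrite frame.
  pose s2 := ev (Query 8 6 6) s1; pose s3' := ev (forall_scan 6 7) s2.
  have frame3 r : r \notin [:: 7; 8; 9] -> reg s3' r = reg s1 r.
    move=> hr; rewrite forall_scan_frame // /s2 /= /upd.
    by move: hr; rewrite !inE => /norP[_ /norP[/negPf-> _]].
  have [|||| mem3 r3] := @forall_scanP 6 7 (p x) (p x x) s2; rewrite ?/upd //=.
  - by rewrite s16 oracle_rank.
  - by move=> s'' y -> ->; rewrite /upd /= s16 oracle_rank.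
  rewrite -/s3' /= in mem3 r3; rewrite -/s2 -/s3'.
  rewrite r3 frame3 // s13 lt0b.
  set N := marked (Defs.mem s1) in M15 M1_agreed M1max r3 *.
  have subE : [forall y in N, p x y] = (N \subset row x).
    apply/forall_inP/subsetP => h y /h; by rewrite inE.
  rewrite subE in r3 *; case: ifP => [/andP[pxx Nx]|no] /=.
  - rewrite (@copy_rowP x) ?frame3 //= /upd /= eval_frame //= s14; split => //.
      by move=> _; apply/agreedP; exists x; rewrite // inE.
    move=> y; rewrite mem_rcons inE => /predU1P[-> //|yxs] pyy xy.
    (* For [y] visited earlier, [N] is included in [row y], so [N = row y] by the invariant; the
       chain from [N] through [row x] to [row y] then collapses. *)
    have Ny := subset_trans Nx xy.
    by apply/eqP; rewrite eqEsubset xy -(M1max _ yxs pyy Ny).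
  - rewrite mem3 -/N /upd /= frame3 //; split => // y.
    rewrite mem_rcons inE => /predU1P[->|yxs] pyy; last exact: M1max.
    by move=> Nx; rewrite pyy Nx in no.
case: eqP => [/M5 M0'|/M_agreed Mok].
  (* A witness [x] lies in its own row, whereas the invariant with [M] empty would make that row
     empty. *)
  move=> N; apply/agreedP => -[x xN /subsetP sub].
  have := Mmax x; rewrite mem_enum M0' sub0set => /(_ isT).
  have : x \in row x by apply: sub.
  by rewrite inE => pxx /(_ pxx isT) /setP/(_ x); rewrite !inE pxx.
split; first by apply/set0Pn; case/agreedP: Mok => x; exists x.
rewrite /selected Mok; apply/forallP => z; apply/implyP => zM.
(* A witness [x] for the extension has [p x x] and [M] inside its row, so [M = row x] already
   contains [z]. *)
apply/agreedP => -[x xzM sub].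
have pxx : p x x by have := subsetP sub x xzM; rewrite inE.
have Mx : M = row x.
  apply: Mmax; rewrite ?mem_enum //.
  by apply: subset_trans sub; apply: subsetUr.
by case/negP: zM; rewrite Mx (subsetP sub) // setU11.
Qed.

(** * The form All, Ex *)

Lemma agreedAEP (N : {set V}) :
  reflect {in N, forall x, exists2 y, y \in N & p x y}
    (agreed (Form All Ex) p N).
Proof.
by apply: (iffP forall_inP) => h x xN; have := h x xN; move/exists_inP.
Qed.

(** Deletions take effect during the pass. This is harmless: an agreed subset keeps its successors
    inside itself, and a pass that deletes nothing has found a successor for every element. *)
Lemma pruneP s (M0 := marked (Defs.mem s))
    (M := marked (Defs.mem (ev prune s))) :
    reg s 0 = #|V| -> reg s 3 = 0 ->
  [/\ M \subset M0,
      forall N, agreed (Form All Ex) p N -> N \subset M0 -> N \subset M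
    & M = M0 -> agreed (Form All Ex) p M].
Proof.
move=> s0 s3.
suff [? ? stable] : [/\ M \subset M0,
      forall N, agreed (Form All Ex) p N -> N \subset M0 -> N \subset M
    & M = M0 -> {in enum V, forall x, x \in M -> exists2 y, y \in M & p x y}].
  split=> // eqM; apply/agreedAEP => x; apply: stable; by rewrite ?mem_enum.
apply: (@for_ind 6 _ (fun xs s' => let M := marked (Defs.mem s') in
  [/\ M \subset M0,
      forall N, agreed (Form All Ex) p N -> N \subset M0 -> N \subset M
    & M = M0 ->
      {in xs, forall x, x \in M -> exists2 y, y \in M & p x y}])) => //.
move=> xs x s1 frame s16 [M1_sub M1_max M1_stable].
have s10 : reg s1 0 = #|V| by rewrite frame.
have s13 : reg s1 3 = 0 by rewrite frame.
pose s2 := ev (Zero 8) s1; pose s3' := ev exists_scan s2.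
have frame3 r : r \notin [:: 7; 8; 9] -> reg s3' r = reg s1 r.
  move=> hr; rewrite exists_scan_frame // /s2 /= /upd.
  by move: hr; rewrite !inE => /norP[_ /norP[/negPf-> _]].
have [|||| mem3 r3] := @exists_scanP x false s2; rewrite ?/upd //=.
rewrite -/s3' /= in mem3 r3; rewrite -/s2 -/s3'.
rewrite r3 frame3 // s13 lt0b.
set N := marked (Defs.mem s1) in M1_sub M1_max M1_stable r3 *.
case: ifP => [/exists_inP[y yN pxy]|no] /=; rewrite mem3.
  split=> // eqN z; rewrite mem_rcons inE => /predU1P[-> _|]; first by exists y.
  exact: M1_stable.
rewrite frame3 // s16 marked_upd /= -/N; split.
- by rewrite (subset_trans _ M1_sub) // subsetDl.
- move=> K hK KM0; have KN := M1_max K hK KM0.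
  rewrite subsetD1 KN; apply/negP => /(agreedAEP _ hK)[y yK pxy].
  by case/exists_inP: no; exists y => //; apply: (subsetP KN).
(* Deleting [x] can give [M0] only if [x] was not marked, so nothing is required at [x]. *)
- move=> eqM; have eqN : N = M0.
    by apply/eqP; rewrite eqEsubset M1_sub -eqM subsetDl.
  have xN : x \notin N by rewrite eqN -eqM !inE eqxx.
  have -> : N :\ x = N by apply/setDidPl; rewrite disjoint_sym disjoints1.
  move=> z; rewrite mem_rcons inE => /predU1P[->|]; first by rewrite (negPf xN).
  exact: M1_stable.
Qed.

#[local] Opaque fill prune.

(** Until the set is agreed, each round removes an element; after [#|V|] rounds the set is agreed or
    empty, and the empty set is agreed. *)
Lemma shrinkP s :
    reg s 0 = #|V| -> reg s 3 = 0 -> reg s 4 = 1 ->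
  let M := marked (Defs.mem (ev shrink s)) in
  agreed (Form All Ex) p M /\
  forall N, agreed (Form All Ex) p N -> N \subset M.
Proof.
move=> s0 s3 s4 M.
suff [M_max [//|]] : (forall N, agreed (Form All Ex) p N -> N \subset M) /\
    (agreed (Form All Ex) p M \/ #|M| + size (enum V) <= #|V|).
  rewrite -cardE -{2}[#|V|]add0n leq_add2r leqn0 cards_eq0 => /eqP M0.
  by split=> //; apply/agreedAEP => x; rewrite M0 inE.
apply: (@for_ind 10 prune (fun xs s' => let M := marked (Defs.mem s') in
  (forall N, agreed (Form All Ex) p N -> N \subset M) /\
  (agreed (Form All Ex) p M \/ #|M| + size xs <= #|V|)) (ev fill s)) => //.
- by rewrite eval_frame.
- rewrite /= fillP ?s4 // addn0 max_card.
  by split=> [N _|]; [apply: subsetT|right].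
- move=> xs x s1 frame _ /= [N_max hN].
  have [||M_sub M_max M_stable] := @pruneP s1.
  + by rewrite frame // eval_frame.
  + by rewrite frame // eval_frame.
  set N := marked (Defs.mem s1) in N_max hN M_sub M_max M_stable *.
  set M1 := marked _ in M_sub M_max M_stable *.
  split=> [K hK|]; first by apply: M_max => //; apply: N_max.
  have [eqM|neqM] := eqVneq M1 N; first by left; apply: M_stable.
  have ltM : #|M1| < #|N| by rewrite proper_card // properEneq neqM.
  (* Once agreed, the set survives the next round whole, contradicting a strict decrease. *)
  case: hN => [hN|leN].
    by rewrite (leq_gtF (subset_leq_card (M_max N hN (subxx _)))) in ltM.
  right; rewrite size_rcons addnS; apply: leq_trans leN.
  by rewrite ltn_add2r.
Qed.

(** * The form Ex, Ex *)

Lemma find_pairP s :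
    reg s 0 = #|V| -> reg s 3 = 0 -> reg s 4 = 1 -> reg s 8 = 0 ->
  let s' := ev find_pair s in
  marked (Defs.mem s') = setT /\ reg s' 8 = [exists x, exists y, p x y].
Proof.
move=> s0 s3 s4 s8; rewrite -has_enum.
(* Register 8 is not reset between scans, so it accumulates the disjunction over [x]. *)
apply: (@for_ind 6 exists_scan (fun xs s' => marked (Defs.mem s') = setT /\
  reg s' 8 = has (fun x => [exists y, p x y]) xs) (ev fill s)) => //.
- by rewrite eval_frame.
- by rewrite /= fillP ?s4 // /upd /= eval_frame.
move=> xs x s1 frame s16 [s1T s18].
have [|||mem2 r2] := exists_scanP _ _ _ s18 (x := x) => //.
- by rewrite frame // eval_frame.
- by rewrite frame // eval_frame.
rewrite has_rcons /= /upd /= mem2 r2 s1T orbC; split => //.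
by congr (nat_of_bool (_ || _)); apply: eq_existsb => y; rewrite inE.
Qed.

(* Correctness of the whole program and the time bound *)
#[local] Opaque greedy_clique ascend shrink find_pair.

(** The final [Move] puts the success flag where [output] reads it, once the loops no longer need
    the size held there. *)
Lemma selectP f (s := ev (Seq select (Move 0 5)) (init f #|V|)) :
  selection_outcome f p (output V s).
Proof.
have marked0 : marked (fun=> 0) = set0 by apply/setP => x; rewrite !inE.
rewrite /output -/(marked _) /s {s} /=.
set s1 := set_reg _ 4 _.
case: f @s1 => -[] [] s1; rewrite /= /upd /=.
- by rewrite eval_frame //=; apply: greedy_cliqueP.
- rewrite eval_frame //=; have [||| M_agreed M_max] := @shrinkP s1; rewrite //=.
  split; last first.
    by move=> M0 N /andP[/M_max]; rewrite M0 subset0 => /eqP.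
  (* An agreed [x |: M] would be included in the largest agreed set [M]. *)
  rewrite /selected M_agreed; apply/forallP => x; apply/implyP.
  by apply: contra => /M_max/subsetP; apply; rewrite setU11.
- have /= := @ascendP s1; rewrite /upd /=.
  move/(_ erefl erefl erefl erefl marked0).
  case: ifP => _ => [h N|[/eqP M_neq0 ?]].
    by rewrite /selected (negPf (h N)).
  by split=> // M_eq0; case: M_neq0.
- have [||||-> ->] := @find_pairP s1; rewrite //=.
  case: existsP => [[x /existsP[y pxy]]|no] /=.
    split; last by move=> /setP/(_ x); rewrite !inE.
    apply/andP; split; last by apply/forallP => z; rewrite inE.
    by apply/exists_inP; exists x => //; apply/exists_inP; exists y.
  move=> N; apply/negP => /andP[/exists_inP[x _ /exists_inP[y _ pxy]] _].
  by case: no; exists x; apply/existsP; exists y.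
Qed.

End Universe.

Theorem lemma4p6p1 :
  exists (c : prog) (P : {poly nat}),
  forall (f : sel_form) (V : finType) (p : rel V),
  exists (t : nat) (s : state),
    [/\ exec (oracle p) c (init f #|V|) t s,
        t <= P.[#|V|]%R
      & selection_outcome f p (output V s)].
Proof.
(* The last instruction overwrites register 0, so [exec_eval] is applied to [select] alone and one
   step is added. *)
exists (Seq select (Move 0 5)), (cost select + 1%:P)%R => f V p.
have [||t le_t e] := @exec_eval (oracle p) select (init f #|V|) => //.
exists (t + 1), (eval (oracle p) (Seq select (Move 0 5)) (init f #|V|)).
split; last exact: selectP.
- by apply: ExecSeq e _; apply: ExecMove.
- by rewrite hornerD hornerC leq_add.
Qed.
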